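(* Let $\mathbb{F}$ be a subfield of $\mathbb{C}$, let $n\ge 2$, let $m_1,\dots,m_n$ be positive integers and let $f_i\in\mathbb{F}[x_1,\dots,x_i]$ for $i\in\{1,\dots,n-1\}$. With the operators $\sigma_{r+1,\ell}$ defined in the context, the set $$\{\sigma_{n,\ell_n}\sigma_{n-1,\ell_{n-1}}\cdots\sigma_{2,\ell_2}(x_1^{\ell_1})\mid \ell_1\in\{0,1,\dots,m_1-1\},\ \ell_2,\dots,\ell_n\in\mathbb{N}\}$$ forms a basis of the space of all polynomial solutions $u\in\mathbb{F}[x_1,\dots,x_n]$ of the partial differential equation $$(\partial_{x_1}^{m_1}+f_1\partial_{x_2}^{m_2}+\cdots+f_{n-1}\partial_{x_n}^{m_n})(u)=0.$$
   Context: $\mathbb{N}$ is the set of nonnegative integers. For each $i$, $\int_{(x_i)}$ is the linear operator on $\mathbb{F}[x_1,\dots,x_n]$ that sends a monomial $x_1^{\alpha_1}\cdots x_n^{\alpha_n}$ to $\frac{1}{\alpha_i+1}x_i\,x_1^{\alpha_1}\cdots x_n^{\alpha_n}$, and $\int_{(x_i)}^{(m)}$ denotes its $m$-th power (the identity for $m=0$). Put $d_1=\partial_{x_1}^{m_1}$ and $d_r=\partial_{x_1}^{m_1}+f_1\partial_{x_2}^{m_2}+\cdots+f_{r-1}\partial_{x_r}^{m_r}$ for $2\le r\le n$. Define linear operators $d_s^-$ inductively by $d_1^-=\int_{(x_1)}^{(m_1)}$ and $$d_{s+1}^-=\sum_{i=0}^\infty(-d_s^-f_s)^i\,d_s^-\,\partial_{x_{s+1}}^{i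 m_{s+1}},$$ where $f_s$ denotes the operator of multiplication by $f_s$ (the sum is finite on each polynomial). For $r\in\{1,\dots,n-1\}$, $h\in\mathbb{F}[x_1,\dots,x_r]$ with $d_r(h)=0$, and $\ell\in\mathbb{N}$, define $$\sigma_{r+1,\ell}(h)=\sum_{i=0}^\infty(-d_r^-f_r)^i(h)\,\partial_{x_{r+1}}^{i m_{r+1}}(x_{r+1}^{\ell}),$$ which is a finite sum. *)

(* Defs.v *)
From HB Require Import structures.
From mathcomp Require Import all_boot all_order all_algebra.
From mathcomp Require Import classical_sets functions cardinality fsbigop reals.
From mathcomp Require Import complex mpoly.

Set Implicit Arguments.
Unset Strict Implicit.
Unset Printing Implicit Defensive.

Import GRing.Theory.
Local Open Scope classical_set_scope.
Local Open Scope ring_scope.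

Section Basis.
Variables (F : fieldType) (V : lmodType F).

Definition lin_indep (S : set V) : Prop :=
  forall (s : seq V) (c : V -> F), uniq s -> (forall u, u \in s -> S u) ->
    \sum_(u <- s) c u *: u = 0 -> forall u, u \in s -> c u = 0.

Definition lin_span (S : set V) : set V :=
  [set v | exists (s : seq V) (c : V -> F),
     (forall u, u \in s -> S u) /\ v = \sum_(u <- s) c u *: u].

Definition is_basis (S W : set V) : Prop :=
  [/\ S `<=` W, lin_indep S & W `<=` lin_span S].

End Basis.

(* The polynomial ring has n.+1 variables x_1, ..., x_(n.+1).  The families
   m, f and l are indexed from 1 by natural numbers; only their entries
   m 1, ..., m n.+1, f 1, ..., f n and l 1, ..., l n.+1 are ever used.
   F[x_1, ..., x_k] is the subring cut out by in_vars k, and all operators are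
   total functions on the full ring; in particular sigma r l h is defined even
   when h is not in F[x_1, ..., x_r] or not killed by dop r. *)
Section Operators.
Variables (F : fieldType) (n : nat).
Local Notation poly := {mpoly F[n.+1]}.

(* the index in 'I_n.+1 of the variable x_i, for 1 <= i <= n.+1 *)
Definition var (i : nat) : 'I_n.+1 := inord i.-1.

Definition in_vars (k : nat) (p : poly) : Prop :=
  forall mu, mu \in msupp p -> forall j : 'I_n.+1, (k <= j)%N -> mu j = 0%N.

Definition mint (i : 'I_n.+1) (p : poly) : poly :=
  \sum_(mu <- msupp p) p@_mu *: (((mu i).+1%:R)^-1 *: ('X_i * 'X_[mu])).

Variables (m : nat -> nat) (f : nat -> poly).

Definition dop (r : nat) (p : poly) : poly :=
  p^`M(var 1, m 1) +
  \sum_(1 <= i < r) f i * p^`M(var i.+1, m i.+1).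

(* d_r^-; the value at r = 0 is junk *)
Fixpoint dminus (r : nat) (p : poly) : poly :=
  if r is s.+1 then
    if s is 0 then iter (m 1) (mint (var 1)) p
    else \sum_(i \in [set: nat])
           iter i (fun q => - dminus s (f s * q))
             (dminus s (p^`M(var s.+1, (i * m s.+1)%N)))
  else 0.

(* sigma_{r+1,l}(h) *)
Definition sigma (r l : nat) (h : poly) : poly :=
  \sum_(i \in [set: nat])
    iter i (fun q => - dminus r (f r * q)) h *
    ('X_(var r.+1) ^+ l)^`M(var r.+1, (i * m r.+1)%N).

(* sigma_{r,l_r} ... sigma_{2,l_2}(x_1^{l_1}); the value at r = 0 is junk *)
Fixpoint sigmas (l : nat -> nat) (r : nat) : poly :=
  if r is s.+1 then
    if s is 0 then 'X_(var 1) ^+ l 1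
    else sigma s (l s.+1) (sigmas l s)
  else 0.

(* The infinite sums above have finite support, so that \sum_(i \in _) does
   not take its default value 0. *)

Lemma mderivn_eq0 (i : 'I_n.+1) k (p : poly) :
  (msize p <= k)%N -> p^`M(i, k) = 0.
Proof.
move=> le_pk; rewrite mderivnE big_seq big1 // => mu /msize_mdeg_lt lt_mu.
rewrite ffact_small ?mul0r ?scale0r //.
apply: leq_trans le_pk; apply: leq_ltn_trans lt_mu.
by rewrite mdegE (bigD1 i) //= leq_addr.
Qed.

Lemma fsum_ord (N : nat) (G : nat -> poly) :
  (forall i, (N <= i)%N -> G i = 0) ->
  \sum_(i \in [set: nat]) G i = \sum_(i < N) G i.
Proof.
move=> G0; rewrite (@fsbig_ord _ _ +%R N G); apply/esym/fsbig_widen => //.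
by move=> i [_ /= /negP]; rewrite -leqNgt => /G0.
Qed.

Lemma mint0 i : mint i 0 = 0.
Proof. by rewrite /mint msupp0 big_nil. Qed.

Lemma dminusE r (p : poly) : (0 < r)%N ->
  dminus r.+1 p =
  \sum_(i \in [set: nat]) iter i (fun q => - dminus r (f r * q))
                            (dminus r (p^`M(var r.+1, (i * m r.+1)%N))).
Proof. by case: r. Qed.

Lemma dminus0 r : dminus r 0 = 0.
Proof.
elim: r => // -[_|r IH]; first by rewrite /=; elim: (m 1) => //= k ->; exact: mint0.
rewrite dminusE // (@fsum_ord 0) ?big_ord0 // => i _.
rewrite mderivn_eq0 ?msize0 // IH.
by elim: i => [|i IHi] //; rewrite iterS IHi mulr0 IH oppr0.
Qed.

Lemma iter_dminus0 r g i : iter i (fun q => - dminus r (g * q)) 0 = 0.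
Proof. by elim: i => //= i ->; rewrite mulr0 dminus0 oppr0. Qed.

Lemma dminusS r N (p : poly) : (0 < r)%N -> (0 < m r.+1)%N -> (msize p <= N)%N ->
  dminus r.+1 p =
  \sum_(i < N) iter i (fun q => - dminus r (f r * q))
                 (dminus r (p^`M(var r.+1, (i * m r.+1)%N))).
Proof.
move=> r_gt0 m_gt0 le_pN; rewrite dminusE //; apply: fsum_ord => i le_Ni.
rewrite mderivn_eq0 ?dminus0 ?iter_dminus0 //.
by apply: leq_trans (leq_pmulr _ m_gt0); exact: leq_trans le_Ni.
Qed.

Lemma sigmaE r l N (h : poly) : (0 < m r.+1)%N -> (l < N)%N ->
  sigma r l h =
  \sum_(i < N) iter i (fun q => - dminus r (f r * q)) h *
    ('X_(var r.+1) ^+ l)^`M(var r.+1, (i * m r.+1)%N).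
Proof.
move=> m_gt0 lt_lN; apply: fsum_ord => i le_Ni.
rewrite mderivn_eq0 ?mulr0 // mpolyXn msizeX mdegMn mdeg1 mul1n.
by apply: leq_trans (leq_pmulr _ m_gt0); exact: leq_trans le_Ni.
Qed.

End Operators.

Arguments var {n} i.

(* Main.v *)
Require Import Defs.
From HB Require Import structures.
From mathcomp Require Import all_boot all_order all_algebra.
From mathcomp Require Import classical_sets functions cardinality fsbigop reals.
From mathcomp Require Import complex mpoly.

Import GRing.Theory.
Local Open Scope classical_set_scope.
Local Open Scope ring_scope.

Set Implicit Arguments.
Unset Strict Implicit.
Unset Printing Implicit Defensive.

(* Every value of [d_r^-] is divisible by [x_1^(m_1)], because this holds for
   [d_1^-].  Hence [sigma_{n,l_n} ... sigma_{2,l_2} (x_1^(l_1))] is the monomial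
   [x_1^(l_1) ... x_n^(l_n)] plus a multiple of [x_1^(m_1)].  It is a solution
   because [d_r d_r^- = 1], which makes the defining sums telescope.  On the other
   hand no nonzero solution is divisible by [x_1^(m_1)].  So a solution is
   determined by its terms of degree less than [m_1] in [x_1], and any such terms
   are matched by a unique linear combination of the proposed basis. *)

(** * Linear combinations of families with repetitions *)

Section Span.
Variables (F : fieldType) (V : lmodType F).

(** [lin_span] attaches a coefficient to each vector, not to each index, and [g] may repeat values;
    so the coefficients of all indices with the same image are added up. *)
Lemma lin_span_sum (I : eqType) (S : set V) (r : seq I) (a : I -> F) (g : I -> V) :
  (forall i, i \in r -> S (g i)) -> lin_span S (\sum_(i <- r) a i *: g i).
Proof.
move=> Sg; exists (undup (map g r)), (fun u => \sum_(i <- r | g i == u) a i).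
split=> [u|]; first by rewrite mem_undup => /mapP[i ri ->]; exact: Sg.
under [RHS]eq_bigr do rewrite scaler_suml.
rewrite (exchange_big_dep predT) //= big_seq [RHS]big_seq.
apply: eq_bigr => i ri; rewrite -big_filter.
have -> : [seq u <- undup (map g r) | g i == u] = [:: g i].
  under eq_filter do rewrite eq_sym.
  by rewrite filter_pred1_uniq ?undup_uniq // mem_undup map_f.
by rewrite big_seq1.
Qed.

End Span.

(** * Iterated partial derivatives and divisibility by powers of a variable *)

Section MultivariatePolynomials.
Variables (F : fieldType) (n : nat).
Local Notation poly := {mpoly F[n]}.
Implicit Types (p q : poly) (i j : 'I_n).

Lemma mderivn_mderivC i j k p : p^`M(i, k)^`M(j) = p^`M(j)^`M(i, k).
Proof. by elim: k p => [|k IH] p; rewrite ?mderivn0 // !mderivSn IH mderiv_comm. Qed.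

Lemma mderivnD i a b p : p^`M(i, a + b) = p^`M(i, b)^`M(i, a).
Proof. by rewrite !mderivn_iter iterD. Qed.

Lemma mderivnMl i k p q : p^`M(i) = 0 -> (p * q)^`M(i, k) = p * q^`M(i, k).
Proof.
move=> p0; elim: k => [|k IH]; first by rewrite !mderivn0.
by rewrite !mderivnS IH mderivM p0 mul0r add0r.
Qed.

Lemma mderivXn_neq i j l : i != j -> ('X_i ^+ l : poly)^`M(j) = 0.
Proof.
by move=> ij; rewrite mpolyXn mderivX mulmnE mnm1E (negPf ij) mul0n scale0r.
Qed.

(* [x_i^e] divides [p] *)
Definition Xdvd i e p := forall mu : 'X_{1..n}, (mu i < e)%N -> p@_mu = 0.

Lemma Xdvd0 i e : Xdvd i e 0.
Proof. by move=> mu _; rewrite mcoeff0. Qed.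

Lemma Xdvd_geq i e e' p : (e <= e')%N -> Xdvd i e' p -> Xdvd i e p.
Proof. by move=> le_e d mu /leq_trans lt_mu; apply/d/lt_mu. Qed.

Lemma XdvdD i e p q : Xdvd i e p -> Xdvd i e q -> Xdvd i e (p + q).
Proof. by move=> dp dq mu lt_mu; rewrite mcoeffD dp ?dq ?addr0. Qed.

Lemma XdvdN i e p : Xdvd i e p -> Xdvd i e (- p).
Proof. by move=> dp mu lt_mu; rewrite mcoeffN dp ?oppr0. Qed.

Lemma Xdvd_sum (I : Type) (r : seq I) (P : pred I) (G : I -> poly) i e :
  (forall a, P a -> Xdvd i e (G a)) -> Xdvd i e (\sum_(a <- r | P a) G a).
Proof.
by move=> dG; apply: big_ind => //; [exact: Xdvd0 | move=> p q; exact: XdvdD].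
Qed.

Lemma XdvdMl i e p q : Xdvd i e q -> Xdvd i e (p * q).
Proof.
move=> dq mu lt_mu; rewrite mcoeffM big1 // => -[k1 k2] /= /eqP/mnmP/(_ i).
rewrite mnmDE => mu_i; rewrite (dq k2) ?mulr0 //; apply: leq_ltn_trans lt_mu.
by rewrite mu_i leq_addl.
Qed.

Lemma XdvdMr i e p q : Xdvd i e p -> Xdvd i e (p * q).
Proof. by rewrite mulrC; exact: XdvdMl. Qed.

Lemma Xdvd_mderivn i j e k p : i != j -> Xdvd i e p -> Xdvd i e p^`M(j, k).
Proof.
move=> ij dp; elim: k => [|k IH]; first by rewrite mderivn0.
move=> mu lt_mu; rewrite mderivnS mcoeff_deriv IH ?mul0rn //.
by rewrite mnmDE mnm1E eq_sym (negPf ij) addn0.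
Qed.

Lemma Xdvd_eq0 i p : (forall e, Xdvd i e p) -> p = 0.
Proof. by move=> dp; apply/mpolyP => mu; rewrite mcoeff0 (dp (mu i).+1). Qed.

End MultivariatePolynomials.

(** * Integration in one variable *)

Section Kernel.
Variables (F : fieldType) (n : nat).
Hypothesis charF : forall k, (k.+1%:R : F) != 0.
Local Notation poly := {mpoly F[n.+1]}.
Implicit Types (p q h : poly).

Lemma var_neq a b : (a < b)%N -> (b < n.+1)%N -> var a.+1 != var b.+1 :> 'I_n.+1.
Proof.
move=> ab bn; rewrite -val_eqE /= !inordK ?neq_ltn ?ab //.
exact: ltn_trans ab bn.
Qed.

Lemma in_vars_mderiv k (j : 'I_n.+1) p : in_vars k p -> (k <= j)%N -> p^`M(j) = 0.
Proof.
move=> kp kj; apply/mpolyP => mu; rewrite mcoeff_deriv mcoeff0.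
have [/kp/(_ j kj)|/memN_msupp_eq0->] := boolP ((mu + U_(j))%MM \in msupp p).
  by rewrite mnmDE mnm1E eqxx addn1.
by rewrite mul0rn.
Qed.

Lemma mcoeff_mint i p mu :
  (mint i p)@_mu =
  if mu i is k.+1 then k.+1%:R^-1 * p@_(mu - U_(i)) else 0.
Proof.
rewrite /mint raddf_sum /=.
under eq_bigr do rewrite !mcoeffZ -mpolyXD mcoeffX.
case mui: (mu i) => [|k].
  rewrite big1 // => nu _; case: eqP => [nu_mu|]; last by rewrite !mulr0.
  by move: mui; rewrite -nu_mu mnmDE mnm1E eqxx.
rewrite [p in RHS]mpolyE raddf_sum mulr_sumr /=; apply: eq_bigr => nu _.
rewrite mcoeffZ mcoeffX mulrCA.
have Umu : (U_(i) <= mu)%MM by rewrite lep1mP mui.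
have -> : ((U_(i) + nu)%MM == mu) = (nu == (mu - U_(i))%MM).
  apply/eqP/eqP => [<-|->]; last by rewrite addmC submK.
  by rewrite addmC addmK.
have [->|_] := eqP; last by rewrite !mulr0.
by rewrite mnmBE mui mnm1E eqxx subn1.
Qed.

Lemma mintK i : cancel (mint i) (mderiv i : poly -> poly).
Proof.
move=> p; apply/mpolyP => mu.
rewrite mcoeff_deriv mcoeff_mint mnmDE mnm1E eqxx addn1 addmK.
by rewrite -[LHS]mulr_natl mulrA divff ?mul1r.
Qed.

Lemma mint_mderivC (i j : 'I_n.+1) p : i != j -> (mint i p)^`M(j) = mint i p^`M(j).
Proof.
move=> ij; apply/mpolyP => mu; rewrite mcoeff_deriv !mcoeff_mint mnmDE mnm1E.
rewrite eq_sym (negPf ij) addn0; case mui: (mu i) => [|k]; first by rewrite mul0rn.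
rewrite mcoeff_deriv mnmBE mnm1E (negPf ij) subn0 -mulrnAr.
congr (_ * (_@__ *+ _)); apply/mnmP => a; rewrite !(mnmDE, mnmBE, mnm1E).
case: (eqVneq i a) => [<-|_]; last by rewrite !subn0.
by rewrite mui eq_sym (negPf ij) !addn0.
Qed.

Lemma Xdvd_mint i e p : Xdvd i e p -> Xdvd i e.+1 (mint i p).
Proof.
move=> dp mu; rewrite mcoeff_mint; case mui: (mu i) => [//|k] lt_k.
by rewrite dp ?mulr0 // mnmBE mui mnm1E eqxx subn1.
Qed.

Lemma Xdvd_iter_mint i k p : Xdvd i k (iter k (mint i) p).
Proof. by elim: k => [|k IH] //=; exact: Xdvd_mint. Qed.

(** * The operators d_r and their right inverses d_r^- *)

Variables (m : nat -> nat) (f : nat -> poly).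
Hypothesis m_gt0 : forall i, (1 <= i <= n.+1)%N -> (0 < m i)%N.
Hypothesis f_vars : forall i, (1 <= i <= n)%N -> in_vars i (f i).

Local Notation D := (dop m f).
Local Notation T := (dminus m f).
Local Notation step r := (fun q => - T r (f r * q)).

Local Arguments dminus : simpl never.

Fact dop_is_linear r : linear (D r).
Proof.
move=> c p q; rewrite /dop linearP scalerDr -!addrA; congr (_ + _).
rewrite addrCA; congr (_ + _); rewrite scaler_sumr -big_split /=.
by apply: eq_bigr => i _; rewrite linearP mulrDr scalerAr.
Qed.

HB.instance Definition _ r :=
  GRing.isLinear.Build F poly poly *:%R (D r) (dop_is_linear r).

Lemma dop1 p : D 1 p = p^`M(var 1, m 1).
Proof. by rewrite /dop big_geq // addr0. Qed.

Lemma dminus1 p : T 1 p = iter (m 1) (mint (var 1)) p.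
Proof. by []. Qed.

Lemma dopS r p : (0 < r)%N -> D r.+1 p = D r p + f r * p^`M(var r.+1, m r.+1).
Proof. by move=> r_gt0; rewrite /dop big_nat_recr //= addrA. Qed.

(** As [q] does not involve x_1, ..., x_r, it is a constant for every derivative in d_r. *)
Lemma dopMr r p q : (0 < r)%N ->
  (forall i, (i < r)%N -> q^`M(var i.+1) = 0) -> D r (p * q) = D r p * q.
Proof.
move=> r_gt0 q0; rewrite /dop mulrDl mulr_suml; congr (_ + _).
  by rewrite [p * q]mulrC mderivnMl; [rewrite mulrC | exact: q0].
rewrite big_nat [RHS]big_nat; apply: eq_bigr => i /andP[_ ir].
by rewrite [p * q]mulrC mderivnMl; [rewrite -mulrA [q * _]mulrC | exact: q0].
Qed.

Lemma f_mderiv r k : (0 < r <= k)%N -> (k < n.+1)%N -> (f r)^`M(var k.+1) = 0.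
Proof.
move=> /andP[r_gt0 rk] kn; apply: (@in_vars_mderiv r); last by rewrite inordK.
by apply: f_vars; rewrite r_gt0 (leq_trans rk).
Qed.

Lemma iter_step_mderiv r j i p :
  (forall q, (T r q)^`M(j) = T r q^`M(j)) -> (f r)^`M(j) = 0 ->
  (iter i (step r) p)^`M(j) = iter i (step r) p^`M(j).
Proof.
move=> Tj fj; elim: i => //= i IH.
by rewrite mderivN Tj mderivM fj mul0r add0r IH.
Qed.

(** By induction, d_r^- is built from integration in x_1, multiplication by f_1, ..., f_(r-1), which
    do not involve x_(k+1), and other derivatives. *)
Lemma dminus_mderiv r k p : (0 < r <= k)%N -> (k < n.+1)%N ->
  (T r p)^`M(var k.+1) = T r p^`M(var k.+1).
Proof.
move=> /andP[r_gt0 rk] kn; elim: r r_gt0 rk p => [//|[|r] IH _ rk] p.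
  rewrite !dminus1; elim: (m 1) => //= e; rewrite mint_mderivC => [-> //|].
  exact: var_neq.
have {}IH := IH isT (ltnW rk).
have mr : (0 < m r.+2)%N by apply: m_gt0; rewrite /= (leq_trans rk) // ltnW.
(* A common truncation bound lets both sums be compared term by term. *)
pose N := maxn (msize p) (msize p^`M(var k.+1)).
rewrite !(@dminusS _ _ _ _ _ N) ?leq_maxl ?leq_maxr // raddf_sum /=.
apply: eq_bigr => i _; rewrite (@iter_step_mderiv r.+1) //; last first.
  by apply: f_mderiv; rewrite ?(ltnW rk).
by rewrite IH mderivn_mderivC.
Qed.

Lemma iter_stepS_mderivn r a i p : (0 < r <= n)%N ->
  (iter i (step r) p)^`M(var r.+1, a) = iter i (step r) p^`M(var r.+1, a).
Proof.
move=> /andP[r_gt0 rn]; elim: a p => [|a IH] p; first by rewrite !mderivn0.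
rewrite !mderivSn -IH iter_step_mderiv // => [q|].
  by apply: dminus_mderiv; rewrite ?r_gt0 /=.
by apply: f_mderiv; rewrite ?r_gt0 /=.
Qed.

Lemma dminus_mderivn r a p : (0 < r <= n)%N ->
  (T r p)^`M(var r.+1, a) = T r p^`M(var r.+1, a).
Proof.
move=> /andP[r_gt0 rn]; elim: a p => [|a IH] p; first by rewrite !mderivn0.
by rewrite !mderivSn -IH dminus_mderiv ?r_gt0 /=.
Qed.

(** Telescoping: in d_(r+1) = d_r + f_r d^m, with d^m the derivative in x_(r+1), d_r on term i+1
    cancels f_r d^m on term i. What remains is d_r on term 0, which is [p] by induction, and f_r d^m
    on the last term, which vanishes for degree reasons. *)
Lemma dminusK r p : (0 < r <= n.+1)%N -> D r (T r p) = p.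
Proof.
elim: r p => [//|[|r] IH] p /= rn.
  rewrite dop1 dminus1 mderivn_iter; elim: (m 1) p => // k IHk p.
  by rewrite iterSr iterS mintK.
have {}IH q : D r.+1 (T r.+1 q) = q by apply: IH; exact: ltnW.
have mr : (0 < m r.+2)%N by exact: m_gt0.
(* The successor makes the truncated sum nonempty, so that its first and last terms can be split
   off. *)
rewrite dopS // (@dminusS _ _ _ _ _ (msize p).+1) // !raddf_sum /=.
rewrite big_ord_recl /= mderivn0 IH mulr_sumr [X in _ + X]big_ord_recr /=.
rewrite iter_stepS_mderivn ?dminus_mderivn // -mderivnD -mulSn.
rewrite [X in T _ X]mderivn_eq0; last first.
  by apply: leq_trans (leq_pmulr _ mr).
rewrite dminus0 iter_dminus0 mulr0 addr0 -addrA -big_split /= big1 ?addr0 //.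
move=> i _; rewrite raddfN /= IH iter_stepS_mderivn ?dminus_mderivn //.
by rewrite -mderivnD -mulSn addNr.
Qed.

(** In each summand of d_(r+1)^- the outermost operator is d_r^-, up to sign, so divisibility passes
    up from d_1^-. *)
Lemma Xdvd_dminus r p : (0 < r <= n.+1)%N -> Xdvd (var 1) (m 1) (T r p).
Proof.
elim: r p => [//|[|r] IH] p /= rn; first by rewrite dminus1; exact: Xdvd_iter_mint.
have {}IH q : Xdvd (var 1) (m 1) (T r.+1 q) by apply: IH; exact: ltnW.
have mr : (0 < m r.+2)%N by exact: m_gt0.
rewrite (@dminusS _ _ _ _ _ (msize p)) //; apply: Xdvd_sum => -[[|i] /= _] _ //.
exact: XdvdN.
Qed.

(** * The polynomials produced by sigma are solutions *)

Lemma sigma_mderiv r k l h : (0 < r < k)%N -> (k < n.+1)%N ->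
  h^`M(var k.+1) = 0 -> (sigma m f r l h)^`M(var k.+1) = 0.
Proof.
move=> /andP[r_gt0 rk] kn hk; have rn : (r < n.+1)%N by exact: ltn_trans kn.
rewrite (@sigmaE _ _ _ _ _ _ l.+1) ?m_gt0 // raddf_sum big1 //= => i _.
rewrite mderivM [X in _ + _ * X]mderivn_mderivC mderivXn_neq ?var_neq //.
rewrite raddf0 mulr0 addr0 iter_step_mderiv => [|q|]; last 2 first.
- by apply: dminus_mderiv => //; rewrite r_gt0 ltnW.
- by apply: f_mderiv => //; rewrite r_gt0 ltnW.
by rewrite hk iter_dminus0 mul0r.
Qed.

(** The telescoping of [dminusK] again, with the first term now killed by d_r h = 0. Since [h] is
    free of x_(r+1), the derivative in x_(r+1) acts only on the power of x_(r+1), which in turn is a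
    constant for d_r. *)
Lemma dop_sigma r l h : (0 < r <= n)%N ->
  D r h = 0 -> h^`M(var r.+1) = 0 -> D r.+1 (sigma m f r l h) = 0.
Proof.
move=> /[dup] rn /andP[r_gt0 r_le_n] Dh h0.
have mr : (0 < m r.+1)%N by exact: m_gt0.
pose X e : poly := ('X_(var r.+1) ^+ l)^`M(var r.+1, e).
have DX q e : D r (q * X e) = D r q * X e.
  apply: dopMr => // i ir.
  by rewrite mderivn_mderivC mderivXn_neq ?raddf0 // eq_sym var_neq.
have dX i : (iter i (step r) h * X (i * m r.+1)%N)^`M(var r.+1, m r.+1) =
            iter i (step r) h * X (i.+1 * m r.+1)%N.
  rewrite mderivnMl; first by rewrite -mderivnD -mulSn.
  by rewrite -nderivn1 iter_stepS_mderivn // nderivn1 h0 iter_dminus0.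
rewrite dopS // (@sigmaE _ _ _ _ _ _ l.+1) // !raddf_sum /=.
rewrite big_ord_recl DX Dh mul0r add0r mulr_sumr [X in _ + X]big_ord_recr /=.
rewrite dX [X in _ * (_ * X)]mderivn_eq0; last first.
  by rewrite mpolyXn msizeX mdegMn mdeg1 mul1n leq_pmulr.
rewrite !mulr0 addr0 -big_split big1 // => i _ /=.
rewrite DX dX raddfN /= dminusK; last by rewrite r_gt0 leqW.
by rewrite mulNr mulrA addNr.
Qed.

(** The subtracted product is term 0 of the sum; every later term has a value of d_r^- as a
    factor. *)
Lemma Xdvd_sigma r l h : (0 < r <= n)%N ->
  Xdvd (var 1) (m 1) (sigma m f r l h - h * 'X_(var r.+1) ^+ l).
Proof.
move=> /andP[r_gt0 r_le_n].
have mr : (0 < m r.+1)%N by exact: m_gt0.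
rewrite (@sigmaE _ _ _ _ _ _ l.+1) // big_ord_recl /= mderivn0 addrAC subrr add0r.
apply: Xdvd_sum => i _; apply/XdvdMr/XdvdN/Xdvd_dminus.
by rewrite r_gt0 leqW.
Qed.

Lemma sigmas_mderiv l r k : (0 < r <= k)%N -> (k < n.+1)%N ->
  (sigmas m f l r)^`M(var k.+1) = 0.
Proof.
elim: r => [//|[|r] IH] /= rk kn; first by rewrite mderivXn_neq ?var_neq.
by apply: sigma_mderiv => //; apply: IH => //; exact: ltnW.
Qed.

Lemma dop_sigmas l r : (0 < r <= n.+1)%N -> (l 1%N < m 1%N)%N ->
  D r (sigmas m f l r) = 0.
Proof.
move=> + l1; elim: r => [//|[|r] IH] rn.
  rewrite dop1 /= mpolyXn mderivnX ffact_small ?scale0r //.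
  by rewrite mulmnE mnm1E eqxx mul1n.
apply: dop_sigma => //; first by apply: IH; exact: ltnW.
by apply: (@sigmas_mderiv l r.+1 r.+1); rewrite ?leqnn.
Qed.

Lemma Xdvd_sigmas_prod l r : (0 < r <= n.+1)%N ->
  Xdvd (var 1) (m 1)
    (sigmas m f l r - \prod_(1 <= i < r.+1) 'X_(var i) ^+ l i).
Proof.
elim: r => [//|[|r] IH] rn; first by rewrite big_nat1 subrr; exact: Xdvd0.
rewrite big_nat_recr //=.
set h := sigmas m f l r.+1; set p := (X in X * _).
(* With x the new variable and e its exponent, the difference splits as (sigma h - h x^e) + (h - p)
   x^e. *)
rewrite -(subrK (h * 'X_(var r.+2) ^+ l r.+2) (sigma _ _ _ _ _)) -addrA -mulrBl.
apply: XdvdD; first exact: Xdvd_sigma.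
by apply: XdvdMr; apply: IH; exact: ltnW.
Qed.

(** * Coefficients of low degree in x_1, and the basis *)

Definition exponent (l : nat -> nat) : 'X_{1..n.+1} := [multinom l j.+1 | j < n.+1].

Lemma Xdvd_sigmas l :
  Xdvd (var 1) (m 1) (sigmas m f l n.+1 - 'X_[exponent l]).
Proof.
have -> : 'X_[exponent l] = \prod_(1 <= i < n.+2) 'X_(var i) ^+ l i :> poly.
  rewrite big_add1 big_mkord mpolyXE_id; apply: eq_bigr => j _.
  by rewrite mnmE /var inord_val.
by apply: Xdvd_sigmas_prod; rewrite /= ltnSn.
Qed.

Lemma exponent_var1 l : exponent l (var 1) = l 1%N.
Proof. by rewrite mnmE inordK. Qed.

Lemma mcoeff_sigmas l (mu : 'X_{1..n.+1}) : (mu (var 1) < m 1%N)%N ->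
  (sigmas m f l n.+1)@_mu = (exponent l == mu)%:R.
Proof.
by move=> /(@Xdvd_sigmas l)/eqP; rewrite mcoeffB subr_eq0 mcoeffX => /eqP.
Qed.

(* Comparing the terms of lowest degree e >= m_1 in x_1: d_1 lowers this degree
   to e - m_1, while no other summand of the operator lowers it. *)
Lemma dop_inj_Xdvd p : D n.+1 p = 0 -> Xdvd (var 1) (m 1) p -> p = 0.
Proof.
move=> Dp dp; apply: (@Xdvd_eq0 _ _ (var 1)) => e.
suff dpe : Xdvd (var 1) (m 1 + e)%N p by exact: Xdvd_geq (leq_addl _ _) dpe.
elim: e => [|e IH]; first by rewrite addn0.
move=> mu; rewrite addnS ltnS leq_eqVlt => /orP[/eqP mu1|]; last exact: IH.
have m1 : (0 < m 1)%N by exact: m_gt0.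
pose u : 'X_{1..n.+1} := (U_(var 1) *+ m 1)%MM.
have u_mu : (u <= mu)%MM.
  apply/mnm_lepP => j; rewrite mulmnE mnm1E.
  by case: eqVneq => [<-|//]; rewrite mul1n mu1 leq_addr.
have {}Dp : (p^`M(var 1, m 1))@_(mu - u) = 0.
  move/eqP: Dp; rewrite /dop addr_eq0 => /eqP ->; rewrite mcoeffN.
  rewrite (_ : Xdvd (var 1) (m 1 + e)%N _) ?oppr0 //.
    rewrite big_nat; apply: Xdvd_sum => i /andP[i0 ni].
    by apply/XdvdMl/Xdvd_mderivn => //; exact: var_neq.
  by rewrite mnmBE mulmnE mnm1E eqxx mul1n mu1 addKn -[ltnLHS]add0n ltn_add2r.
move/eqP: Dp; rewrite mcoeff_mderivm addmC submK // -mulr_natl mulf_eq0.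
case/orP => [|/eqP //]; set c := \prod_(i < _) _.
(* The integer [c] is a product of falling factorials, positive because [u] divides [mu]; by [charF]
   it is nonzero in the field. *)
suff: (0 < c)%N by case: c => // c _; rewrite (negPf (charF c)).
by apply: prodn_gt0 => i; rewrite ffact_gt0; move/mnm_lepP: u_mu; apply.
Qed.

Lemma sigmas_basis :
  is_basis [set u | exists2 l : nat -> nat, (l 1%N < m 1%N)%N & u = sigmas m f l n.+1]
           [set u | D n.+1 u = 0].
Proof.
have Dsig l : (l 1%N < m 1%N)%N -> D n.+1 (sigmas m f l n.+1) = 0.
  by move=> l1; apply: dop_sigmas; rewrite /= ?ltnSn.
split=> [_ [l l1 ->]|s c s_uniq sS|u Du] /=; first exact: Dsig.
- move=> + u us; case: (sS u us) => l l1 u_l.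
  move/(congr1 (mcoeff (exponent l))); rewrite mcoeff0 raddf_sum (bigD1_seq u) //=.
  rewrite big_seq_cond big1 ?addr0 => [|w /andP[ws wu]].
    by rewrite mcoeffZ u_l mcoeff_sigmas ?exponent_var1 // eqxx mulr1.
  case: (sS w ws) => l' l'1 w_l'; rewrite mcoeffZ w_l' mcoeff_sigmas ?exponent_var1 //.
  case: eqP => [e_l|]; last by rewrite mulr0.
  (* Here [l] and [l'] may still differ at indices beyond n+1, so [w = u] is drawn from injectivity:
     the difference is a solution divisible by x_1^(m_1). *)
  case/eqP: wu; apply/eqP; rewrite -subr_eq0; apply/eqP/dop_inj_Xdvd.
    by rewrite linearB /= w_l' u_l !Dsig // subrr.
  have := XdvdD (@Xdvd_sigmas l') (XdvdN (@Xdvd_sigmas l)).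
  by rewrite e_l opprB addrA subrK w_l' u_l.
pose S (mu : 'X_{1..n.+1}) := sigmas m f (fun i => mu (var i)) n.+1.
have exp_mu (mu : 'X_{1..n.+1}) : exponent (fun i => mu (var i)) = mu.
  by apply/mnmP => j; rewrite mnmE /var inord_val.
(* The terms of [u] of degree less than m_1 in x_1 prescribe the combination: each monomial is
   replaced by the solution [S mu] extending it. *)
pose L := [seq mu : 'X_{1..n.+1} <- msupp u | (mu (var 1) < m 1%N)%N].
suff -> : u = \sum_(mu <- L) u@_mu *: S mu.
  apply: lin_span_sum => mu; rewrite mem_filter => /andP[mu1 _].
  by exists (fun i => mu (var i)).
apply/eqP; rewrite -subr_eq0; apply/eqP/dop_inj_Xdvd.
  rewrite linearB linear_sum /= Du big_seq big1 ?subrr // => mu.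
  by rewrite mem_filter => /andP[mu1 _]; rewrite linearZ /= Dsig ?scaler0.
(* At such a [nu], [S mu] has the same coefficient as the monomial [mu], so only the terms of [u]
   outside [L] remain, and they do not contribute. *)
move=> nu nu1; rewrite mcoeffB raddf_sum /=.
under eq_bigr do rewrite mcoeffZ mcoeff_sigmas // exp_mu -mcoeffX -mcoeffZ.
rewrite -raddf_sum big_filter -mcoeffB /=.
rewrite {1}[u]mpolyE (bigID (fun mu : 'X_{1..n.+1} => (mu (var 1) < m 1%N)%N)) /=.
rewrite addrAC subrr add0r raddf_sum big1 //= => mu /negPf mu1.
by rewrite mcoeffZ mcoeffX; case: eqP mu1 => [->|]; rewrite ?nu1 ?mulr0.
Qed.

End Kernel.

Unset Implicit Arguments.

Theorem theorem2p3 (R : realType) (P : pred R[i]) (F : subFieldType P)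
    (n : nat) (hn : (2 <= n.+1)%N)
    (m : nat -> nat) (hm : forall i, (1 <= i <= n.+1)%N -> (0 < m i)%N)
    (f : nat -> {mpoly F[n.+1]})
    (hf : forall i, (1 <= i <= n)%N -> in_vars i (f i)) :
  is_basis
    [set u : {mpoly F[n.+1]} |
       exists2 l : nat -> nat, (l 1 < m 1)%N & u = sigmas m f l n.+1]
    [set u : {mpoly F[n.+1]} | dop m f n.+1 u = 0].
Proof.
apply: sigmas_basis => // k.
(* Characteristic zero is inherited from the complex numbers through the embedding [val]. *)
by rewrite -(fmorph_eq0 (val : {rmorphism F -> R[i]})) rmorph_nat Num.Theory.pnatr_eq0.
Qed.
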